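(* $\widetilde{r}_{ind}(\sigma_{k,\ell}) = \Theta(k^2\ell)$; that is, there are absolute constants $c, C>0$ such that $c\,k^2\ell \le \widetilde{r}_{ind}(\sigma_{k,\ell}) \le C\,k^2\ell$ for all integers $k\ge 3$ and $\ell \ge 2$.
   Context: For integers $k\ge3$ and $\ell\ge2$, the spider $\sigma_{k,\ell}$ is the tree formed as the union of $k$ paths, each of length $\ell$ (i.e. $\ell$ edges), that share exactly one common endpoint. The online Ramsey game for a target graph $H$ is played between Builder and Painter on an infinite set of vertices, initially with no edges. In each round Builder adds a new edge between two vertices (forming the background graph $G$), and Painter immediately colors that edge red or blue. The induced online Ramsey number $\widetilde{r}_{ind}(H)$ is the minimum number $m$ such that Builder has a strategy guaranteeing that, against any Painter strategy, after at most $m$ rounds there is a monochromatic induced copy of $H$ in $G$, i.e. a vertex set $S$ such that the subgraph of $G$ induced on $S$ is isomorphic to $H$ and all its edges have the same color. *)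

(* Defs.v *)
From mathcomp Require Import all_boot all_order all_algebra.
From mathcomp Require Import reals.
Set Implicit Arguments.
Unset Strict Implicit.
Unset Printing Implicit Defensive.

Record sgraph := SGraph {
  vertex :> finType;
  edge : rel vertex;
  edge_sym : symmetric edge;
  edge_irrefl : irreflexive edge
}.

(* [None] is the common endpoint of the legs; [Some (i, j)] is the vertex of
   leg [i] at distance [j + 1] from it, so each leg has [l] edges. *)
Section Spider.
Variables k l : nat.

Definition spider_vertex : finType := option ('I_k * 'I_l).

Definition spider_edge (x y : spider_vertex) : bool :=
  match x, y with
  | None, None => false
  | None, Some (_, j) | Some (_, j), None => nat_of_ord j == 0
  | Some (i, j), Some (i', j') =>
      (i == i') && ((nat_of_ord j' == j.+1) || (nat_of_ord j == j'.+1))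
  end.

Lemma spider_edge_sym : symmetric spider_edge.
Proof.
by move=> [[i j]|] [[i' j']|] //=; rewrite (eq_sym i) orbC.
Qed.

Lemma spider_edge_irrefl : irreflexive spider_edge.
Proof. by move=> [[i j]|] //=; rewrite orbb ltn_eqF ?andbF. Qed.

Definition spider : sgraph := SGraph spider_edge_sym spider_edge_irrefl.

End Spider.

(* The board has vertex set [nat]. A position lists the edges drawn so far,
   oldest first, each with its colour ([true] for red, [false] for blue).
   A pair [(u, v)] stands for the unordered edge [{u, v}]. *)
Definition position := seq ((nat * nat) * bool).

Definition coloured_adj (h : position) (c : bool) (u v : nat) : bool :=
  (((u, v), c) \in h) || (((v, u), c) \in h).

Definition adj (h : position) (u v : nat) : bool :=
  coloured_adj h true u v || coloured_adj h false u v.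

Definition legal_move (h : position) (e : nat * nat) : bool :=
  (e.1 != e.2) && ~~ adj h e.1 e.2.

Definition builder := position -> nat * nat.

Definition painter := position -> nat * nat -> bool.

(* A legal move exists in every position since the board is infinite, so
   demanding legality in unreachable positions too costs Builder nothing. *)
Definition legal_builder (b : builder) : Prop :=
  forall h : position, legal_move h (b h).

Fixpoint play (b : builder) (p : painter) (n : nat) : position :=
  if n is n'.+1 then
    let h := play b p n' in rcons h (b h, p h (b h))
  else [::].

(* The vertex set of the induced copy is the image of [f]. *)
Definition mono_induced_copy (H : sgraph) (h : position) : Prop :=
  exists (f : H -> nat) (c : bool),
    [/\ injective f,
        forall x y : H, adj h (f x) (f y) = edge x y
      & forall x y : H, edge x y -> coloured_adj h c (f x) (f y)].

(* An induced copy may be destroyed by later edges: Builder has won as soon as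
   one is present after some round [n <= m]. *)
Definition builder_wins_within (H : sgraph) (m : nat) : Prop :=
  exists b : builder, legal_builder b /\
    forall p : painter, exists n : nat,
      n <= m /\ mono_induced_copy H (play b p n).

Definition is_induced_online_ramsey (H : sgraph) (r : nat) : Prop :=
  builder_wins_within H r /\
  forall m : nat, builder_wins_within H m -> r <= m.

(* Main.v *)
(** Lower bound: let Painter use red unless this creates a vertex of red degree
    [k].  There is never a red spider, and every blue edge has an end of red
    degree [k - 1]; a blue spider contains a matching of [k * (l / 2)] edges, hence
    that many vertices of red degree [k - 1].

    Upper bound: Builder first forces a monochromatic induced path of linear
    length.  He draws many disjoint edges and keeps those of the majority
    colour, say red.  He then maintains a red path [R] with end [r] and a blue
    path [B] with end [b], without edges between them.  For two unused red edges
    [xy] and [x'y'] he draws [rx], [bx'] and [rb] in turn.  If [rx] is red, [R]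
    grows by [x]; if [bx'] is blue, [B] grows by [x'].  Otherwise [R] grows by
    [b, x', y'] while [B] loses two vertices (when [rb] is red), or [B] grows by
    [r, x] while [R] loses two vertices (when [rb] is blue).  In every case
    [4 |R| + 5 |B|] grows by at least 2.

    From a long induced blue path, cut into segments, a spider is grown as
    follows.  The root is joined to the first vertices of [2k] segments; if [k] of
    these edges are blue, the segments are the legs of a blue spider, otherwise
    there are [k] red legs of length 1.  The end of a red leg is joined to the
    first vertices of [k] segments; either all these edges are blue and there is
    a blue spider, or the leg can be extended.  The first two vertices of each
    segment are then thrown away, which keeps everything induced.  Each of the
    [k * l] vertices of the spider costs [O(k)] edges. *)
Require Import Defs.
From mathcomp Require Import all_boot all_order all_algebra.
From mathcomp Require Import boolp reals.
From mathcomp Require Import zify.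

Set Implicit Arguments.
Unset Strict Implicit.
Unset Printing Implicit Defensive.

(** * Strategies *)

Lemma coloured_adjC h c u v : coloured_adj h c u v = coloured_adj h c v u.
Proof. by rewrite /coloured_adj orbC. Qed.

Lemma adjC h u v : adj h u v = adj h v u.
Proof. by rewrite /adj !(coloured_adjC _ _ u). Qed.

Lemma coloured_adj_adj h c u v : coloured_adj h c u v -> adj h u v.
Proof. by rewrite /adj; case: c => ->; rewrite ?orbT. Qed.

Lemma coloured_adj_rcons h u v d c x y :
  coloured_adj (rcons h ((u, v), d)) c x y =
    coloured_adj h c x y
    || (c == d) && ((x == u) && (y == v) || (y == u) && (x == v)).
Proof.
rewrite /coloured_adj !mem_rcons !inE !xpair_eqE.
case: (c == d); rewrite ?andbT ?andbF //=; last by rewrite !orbF.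
by rewrite orbACA orbC [_ && _ || _]orbC.
Qed.

Lemma adj_rcons h u v d x y :
  adj (rcons h ((u, v), d)) x y =
    adj h x y || ((x == u) && (y == v) || (y == u) && (x == v)).
Proof.
rewrite /adj !coloured_adj_rcons; case: d => /=; rewrite orbF.
  by rewrite orbAC.
by rewrite orbA.
Qed.

(** [Q] may be met at an intermediate round, since later edges can destroy an induced copy. As no
    global [builder] is mentioned, partial strategies can be built by induction and concatenated. *)
Fixpoint forces (m : nat) (Q : position -> Prop) (h : position) : Prop :=
  Q h \/ (if m is m'.+1 then
            exists e, legal_move h e /\
              forall c, forces m' Q (rcons h (e, c))
          else False).

Lemma forces_done m (Q : position -> Prop) h : Q h -> forces m Q h.
Proof. by case: m => [|m]; left. Qed.

Lemma forces_move m (Q : position -> Prop) h u v :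
  u != v -> ~~ adj h u v ->
  (forall c, forces m Q (rcons h ((u, v), c))) -> forces m.+1 Q h.
Proof. by move=> uv nuv F; right; exists (u, v); rewrite /legal_move uv. Qed.

Lemma forces_leq m m' Q h : m <= m' -> forces m Q h -> forces m' Q h.
Proof.
elim: m m' h => [|m IH] [|m'] h //= le_m [Qh|F]; try by left.
by have [e [le F']] := F; right; exists e; split=> // c; apply: IH (F' c).
Qed.

Lemma forces_bind m1 m2 (Q1 Q2 : position -> Prop) h :
  forces m1 Q1 h -> (forall h', Q1 h' -> forces m2 Q2 h') ->
  forces (m1 + m2) Q2 h.
Proof.
move=> F1 F2; elim: m1 h F1 => [|m1 IH] h [/F2 F|] //.
  exact: forces_leq (leq_addl _ _) F.
move=> [e [le F]].
by rewrite addSn; right; exists e; split=> // c; apply: IH (F c).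
Qed.

Arguments forces : simpl never.

Lemma legal_move_exists h : exists e, legal_move h e.
Proof.
pose b := \max_(e <- h) maxn e.1.1 e.1.2.
have lt_b e : e \in h -> maxn e.1.1 e.1.2 <= b.
  by move=> eh; rewrite /b (big_rem e) //= leq_maxl.
exists (b.+1, b.+2); rewrite /legal_move /= neq_ltn ltnSn /=.
rewrite /adj /coloured_adj !negb_or.
by do !(apply/andP; split); apply/negP=> /lt_b /=; lia.
Qed.

Lemma forces_builder_wins H m :
  forces m (mono_induced_copy H) [::] -> builder_wins_within H m.
Proof.
set Q := mono_induced_copy H => F.
pose good h e := legal_move h e /\
  (forces (m - size h) Q h -> ~ Q h ->
   forall c, forces (m - (size h).+1) Q (rcons h (e, c))).
have good_ex h : exists e, good h e.
  have [[F1 nQ]|no] := pselect (forces (m - size h) Q h /\ ~ Q h); last first.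
    have [e le] := legal_move_exists h; exists e; split=> // F1 nQ.
    by case: no.
  move: F1; case E: (m - size h) => [|m'] [] // [e [le F1]].
  by exists e; split=> // _ _ c; rewrite (_ : m - _ = m'); [apply: F1 | lia].
have [b bP] := choice good_ex.
exists b; split=> [h|p]; first by case: (bP h).
(* If no copy ever appeared, the invariant [Fn] would survive up to round [m], where no round is
   left and [Q] itself must hold. *)
apply: contrapT => no.
have sz n : size (play b p n) = n by elim: n => //= n IH; rewrite size_rcons IH.
have Fn n : n <= m -> forces (m - n) Q (play b p n).
  elim: n => [|n IH] le_n; first by rewrite subn0.
  have [_] := bP (play b p n); rewrite sz /= => step.
  apply: step; first by apply: IH; lia.
  by move=> Qn; apply: no; exists n; split=> //; lia.
have := Fn m (leqnn m); rewrite subnn => -[Qm|//].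
by apply: no; exists m.
Qed.

(** * The lower bound *)

Definition touches (v : nat) (a : nat * nat * bool) : bool :=
  a.2 && ((a.1.1 == v) || (a.1.2 == v)).

Definition red_degree (h : position) (v : nat) : nat := count (touches v) h.

Definition degree_painter (d : nat) : painter :=
  fun h e => (red_degree h e.1 < d) && (red_degree h e.2 < d).

Lemma red_degree_rcons h a v :
  red_degree (rcons h a) v = red_degree h v + touches v a.
Proof. by rewrite /red_degree -cats1 count_cat /= addn0. Qed.

Lemma degree_painter_red d b n v : red_degree (play b (degree_painter d) n) v <= d.
Proof.
elim: n => //= n; set h := play _ _ n => IH; rewrite red_degree_rcons.
rewrite /touches /=; have [/andP[lt1 lt2]|_] /= := boolP (degree_painter _ _ _);
  last by rewrite addn0.
case: eqP => [<-|_] /=; first by rewrite addn1.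
by case: eqP => [<-|_]; rewrite ?addn0 ?addn1.
Qed.

(** Red degrees never decrease, so an end that was saturated when the edge was coloured blue stays
    saturated. *)
Lemma degree_painter_blue d b n u v :
  let h := play b (degree_painter d) n in
  coloured_adj h false u v -> (d <= red_degree h u) || (d <= red_degree h v).
Proof.
elim: n => //= n; set h := play _ _ n => IH.
rewrite !red_degree_rcons; case E: (b h) => [x y].
rewrite coloured_adj_rcons => /orP[/IH|/andP[/eqP blue uv]].
  by case/orP=> le_d; apply/orP; [left | right]; apply: leq_trans le_d (leq_addr _ _).
move/esym/negbT: blue; rewrite negb_and -!leqNgt /=.
by case/orP: uv => /andP[/eqP-> /eqP->] /orP[] le_d; apply/orP; [left|right|right|left];
  apply: leq_trans le_d (leq_addr _ _).
Qed.

Lemma leq_red_degree h v (s : seq nat) :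
  uniq s -> {in s, forall w, coloured_adj h true v w} -> size s <= red_degree h v.
Proof.
move=> s_uniq vs; rewrite /red_degree -size_filter.
(* Takes an edge at [v] to its far end; the list may store the edge in either order. *)
pose other (a : nat * nat * bool) := if a.1.1 == v then a.1.2 else a.1.1.
rewrite -(size_map other); apply: uniq_leq_size => // w /vs.
case/orP=> vw; apply/mapP.
  by exists (v, w, true); rewrite ?mem_filter /touches /other /= eqxx.
exists (w, v, true); rewrite ?mem_filter /touches /other /= ?eqxx ?orbT //.
by case: eqP.
Qed.

(** Handshake bound: an edge is counted at most once through each of its two ends, as [s] has no
    repetition. *)
Lemma sum_red_degree h (s : seq nat) :
  uniq s -> \sum_(v <- s) red_degree h v <= 2 * size h.
Proof.
move=> s_uniq; elim: h => [|a h IH] /=; first by rewrite big1_seq.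
rewrite big_split /= mulnS leq_add //.
have count1 (x : nat) : \sum_(v <- s) (x == v) <= 1.
  rewrite -big_mkcond /= sum1_count (eq_count (a2 := pred1 x)).
    by rewrite count_uniq_mem // leq_b1.
  by move=> v /=; rewrite eq_sym.
apply: leq_trans (_ : \sum_(v <- s) ((a.1.1 == v) + (a.1.2 == v)) <= _).
  by apply: leq_sum => v _; rewrite /touches; do !case: eqP; case: a.2.
by rewrite big_split (leq_add (count1 _) (count1 _)).
Qed.

Lemma builder_wins_lower k l m :
  0 < k -> builder_wins_within (spider k l) m -> k * l./2 * k.-1 <= 2 * m.
Proof.
move=> k_gt0 [b [_ /(_ (degree_painter k.-1)) [n [le_nm]]]].
set h := play _ _ _ => -[f [[] [f_inj _ f_col]]].
  (* Red copy: the first vertices of the legs are [k] red neighbours of the centre, whose red degree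
     is at most [k - 1]. For [l = 0] the claim is trivial. *)
  have [l0|l_gt0] := posnP l; first by rewrite l0 /= muln0.
  pose s := [seq f (Some (i, Ordinal l_gt0)) | i <- enum 'I_k].
  have: size s <= red_degree h (f None).
    apply: leq_red_degree => [|_ /mapP[i _ ->]]; last exact: f_col.
    by rewrite map_inj_uniq ?enum_uniq // => i j /f_inj [].
  have := degree_painter_red k.-1 b n (f None).
  by rewrite -/h size_map size_enum_ord; lia.
(* Blue copy: in each leg the vertices of indices [2t] and [2t + 1] are joined, and these edges form
   a matching. [g] selects a saturated end of each, hence is injective. *)
have lt0 (t : 'I_l./2) : t.*2 < l by have := ltn_ord t; lia.
have lt1 (t : 'I_l./2) : t.*2.+1 < l by have := ltn_ord t; lia.
pose near i t := f (Some (i, Ordinal (lt0 t))).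
pose far i t := f (Some (i, Ordinal (lt1 t))).
pose g (a : 'I_k * 'I_l./2) :=
  if k.-1 <= red_degree h (near a.1 a.2) then near a.1 a.2 else far a.1 a.2.
have g_deg a : k.-1 <= red_degree h (g a).
  rewrite /g; case: ifP => // nfull.
  have := @degree_painter_blue k.-1 b n (near a.1 a.2) (far a.1 a.2).
  by rewrite /= -/h nfull /=; apply; apply: f_col => /=; rewrite !eqxx.
have g_inj : injective g.
  move=> [i t] [i' t']; rewrite /g /=.
  case: ifP => _; case: ifP => _ /f_inj [-> tt'];
    by congr (_, _); apply: ord_inj; lia.
pose s := [seq g a | a <- enum {: 'I_k * 'I_l./2}].
have s_uniq : uniq s by rewrite map_inj_uniq ?enum_uniq.
have := sum_red_degree h s_uniq.
have -> : size h = n.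
  by rewrite /h; elim: (n) => //= n' IH; rewrite size_rcons IH.
suff : k * l./2 * k.-1 <= \sum_(v <- s) red_degree h v by lia.
rewrite big_map big_enum /=.
apply: leq_trans (_ : \sum_(a : 'I_k * 'I_l./2) k.-1 <= _).
  by rewrite sum_nat_const card_prod !card_ord.
by apply: leq_sum.
Qed.

(** * Induced paths *)

(** Disjointness and non-adjacency are kept together: this is what makes the union of several
    induced pieces induced. Single vertices are handled as one-element lists. *)
Definition separated (h : position) (s t : seq nat) : bool :=
  all (fun x => all (fun y => (x != y) && ~~ adj h x y) t) s.

Arguments separated : simpl never.

Lemma separatedP h s t :
  reflect (forall x y, x \in s -> y \in t -> (x != y) && ~~ adj h x y)
          (separated h s t).
Proof.
apply: (iffP allP) => [H x y /H /allP xt /xt //|H x xs].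
by apply/allP => y; apply: H.
Qed.

Lemma separatedC h s t : separated h s t = separated h t s.
Proof.
by apply/separatedP/separatedP => H x y xs ys; rewrite eq_sym adjC H.
Qed.

Lemma separated_sub h s t s' t' :
  {subset s' <= s} -> {subset t' <= t} -> separated h s t -> separated h s' t'.
Proof.
move=> ss tt /separatedP H; apply/separatedP => x y /ss xs /tt yt; exact: H.
Qed.

Lemma separated_cons h x s t :
  separated h (x :: s) t = separated h [:: x] t && separated h s t.
Proof. by rewrite /separated /= andbT. Qed.

Lemma separated_consr h x s t :
  separated h s (x :: t) = separated h s [:: x] && separated h s t.
Proof. by rewrite separatedC separated_cons ![separated h _ s]separatedC. Qed.

Lemma separated_rcons h u v c s t :
  ~~ ((u \in s) && (v \in t)) -> ~~ ((v \in s) && (u \in t)) ->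
  separated (rcons h ((u, v), c)) s t = separated h s t.
Proof.
move=> n1 n2; apply/separatedP/separatedP => H x y xs yt; have := H x y xs yt.
  by rewrite adj_rcons negb_or => /andP[-> /andP[]].
rewrite adj_rcons negb_or => /andP[-> ->] /=; apply/negP.
by case/orP=> /andP[/eqP e1 /eqP e2]; move: n1 n2; rewrite -e1 -e2 xs yt.
Qed.

(** Unfolding at the head makes it cheap to add or remove an end vertex there, so the strategies
    keep the growing end first. *)
Fixpoint induced_path (h : position) (c : bool) (s : seq nat) : bool :=
  if s is x :: s' then
    [&& x \notin s',
        (if s' is y :: s'' then
           coloured_adj h c x y && separated h [:: x] s''
         else true) & induced_path h c s']
  else true.

Lemma induced_path_rcons h u v d c s :
  ~~ ((u \in s) && (v \in s)) ->
  induced_path (rcons h ((u, v), d)) c s = induced_path h c s.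
Proof.
elim: s => [//|x s IH] nuv /=.
rewrite {}IH; last by apply: contra nuv => /andP[us vs]; rewrite !inE us vs !orbT.
case: s nuv => [//|y s] nuv; rewrite separated_rcons.
- suff -> : coloured_adj (rcons h (u, v, d)) c x y = coloured_adj h c x y by [].
  rewrite coloured_adj_rcons.
  have [uv|_] := boolP (_ || (y == u) && _); last by rewrite andbF orbF.
  case/negP: nuv; rewrite !inE.
  by case/orP: uv => /andP[/eqP-> /eqP->]; rewrite !eqxx ?orbT.
- by apply: contra nuv; rewrite !inE => /andP[/eqP-> ->]; rewrite eqxx !orbT.
- by apply: contra nuv; rewrite !inE => /andP[/eqP-> ->]; rewrite eqxx !orbT.
Qed.

Lemma induced_path_uniq h c s : induced_path h c s -> uniq s.
Proof. by elim: s => //= x s IH /and3P[-> _ /IH]. Qed.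

Lemma induced_path_behead h c s : induced_path h c s -> induced_path h c (behead s).
Proof. by case: s => //= x s /and3P[]. Qed.

Lemma induced_path_drop h c n s : induced_path h c s -> induced_path h c (drop n s).
Proof. by elim: n s => [|n IH] [|x s] //= /and3P[_ _ /IH]. Qed.

Lemma induced_path_take h c n s : induced_path h c s -> induced_path h c (take n s).
Proof.
elim: n s => [|n IH] [|x s] //= /and3P[xs xy /IH ->]; rewrite andbT.
apply/andP; split; first by apply: contra xs; apply: mem_take.
case: s n xy {xs IH} => [|y s] [|n] //= /andP[->]; apply: separated_sub => //.
exact: mem_take.
Qed.

Lemma induced_path_head_separated h c x s :
  induced_path h c (x :: s) -> separated h [:: x] (behead s).
Proof. by case: s => [|y s] //= /and3P[_ /andP[]]. Qed.

Lemma induced_path_nth h c (s : seq nat) i j :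
  induced_path h c s -> i < j < size s ->
  adj h (nth 0 s i) (nth 0 s j) = (j == i.+1) /\
  (j = i.+1 -> coloured_adj h c (nth 0 s i) (nth 0 s j)).
Proof.
elim: s i j => [|x s IH] i j; first by rewrite andbF.
case: i j => [|i] [|j] //=.
- case: s {IH} => [//|y s] /and3P[_ /andP[xy xs] _].
  case: j => [_|j lt_j] /=; first by rewrite (coloured_adj_adj xy).
  split=> //; apply/negbTE.
  have /separatedP/(_ x (nth 0 s j)) := xs.
  by rewrite mem_head mem_nth // => /(_ isT isT)/andP[].
- move=> /and3P[_ _ P]; rewrite !ltnS => /(IH _ _ P); rewrite eqSS => -[-> H].
  by split=> // -[].
Qed.

(** The strict inequality leaves at least one vertex of the path between the two windows, so no path
    edge joins them. *)
Lemma induced_path_separated h c s o n o' n' :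
  induced_path h c s -> o + n < o' ->
  separated h (take n (drop o s)) (take n' (drop o' s)).
Proof.
move=> P lt_o; apply/separatedP => x y /(nthP 0) [i lt_i <-] /(nthP 0) [j lt_j <-].
move: lt_i lt_j; rewrite !size_take_min !size_drop => lt_i lt_j.
rewrite !nth_take ?nth_drop; try lia.
have lt_s : o' + j < size s.
  by move: lt_j; rewrite leq_min ltn_subRL => /andP[].
have [|-> _] := @induced_path_nth h c s (o + i) (o' + j) P.
  by rewrite lt_s andbT; lia.
rewrite nth_uniq ?(induced_path_uniq P) //; try lia.
Qed.

(** Converse of [induced_path_nth]. The description by indices is symmetric, which gives reversal of
    paths. *)
Lemma induced_path_of_nth h c (s : seq nat) :
  uniq s ->
  (forall i j, i < j < size s ->
     adj h (nth 0 s i) (nth 0 s j) = (j == i.+1) /\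
     (j = i.+1 -> coloured_adj h c (nth 0 s i) (nth 0 s j))) ->
  induced_path h c s.
Proof.
elim: s => [//|x s IH] /= /andP[xs us] H; rewrite xs IH //=; last first.
  move=> i j lt_ij; have [|-> E] := H i.+1 j.+1; rewrite ?eqSS //.
  by split=> // ji; apply: E; rewrite ji.
case: s xs us H {IH} => [//|y s] xs us H; rewrite !andbT.
have [|_ -> //] := H 0 1; first by [].
apply/separatedP => _ z /[1!inE] /eqP-> zs; apply/andP; split.
  by apply: contraNneq xs => ->; rewrite inE zs orbT.
case/(nthP 0): zs => j lt_j <-.
by have [|/= -> _] := H 0 j.+2.
Qed.

Lemma induced_path_rev h c s : induced_path h c s -> induced_path h c (rev s).
Proof.
move=> P; apply: induced_path_of_nth; first by rewrite rev_uniq (induced_path_uniq P).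
move=> i j; rewrite size_rev => lt_ij; rewrite !nth_rev; try lia.
have [|E1 E2] := @induced_path_nth h c s (size s - j.+1) (size s - i.+1) P; first by lia.
rewrite adjC E1 coloured_adjC; split; last by move=> ?; apply: E2; lia.
by apply/eqP/eqP; lia.
Qed.

(** * Forcing a long monochromatic induced path *)

Lemma coloured_adj_new h u v c : coloured_adj (rcons h ((u, v), c)) c u v.
Proof. by rewrite coloured_adj_rcons !eqxx orbT. Qed.

Lemma coloured_adj_mono h a c x y :
  coloured_adj h c x y -> coloured_adj (rcons h a) c x y.
Proof. by case: a => [[u v] d] xy; rewrite coloured_adj_rcons xy. Qed.

Lemma separated_seq1 h x y : separated h [:: x] [:: y] = (x != y) && ~~ adj h x y.
Proof. by rewrite /separated /= !andbT. Qed.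

Lemma separated_neq h x y : separated h [:: x] [:: y] -> x != y.
Proof. by rewrite separated_seq1 => /andP[]. Qed.

Lemma separated_notin h x s : separated h [:: x] s -> x \notin s.
Proof.
move=> /separatedP H; apply/negP => xs.
by have := H x x (mem_head _ _) xs; rewrite eqxx.
Qed.

Definition edge_ends (G : seq (nat * nat)) : seq nat :=
  flatten [seq [:: e.1; e.2] | e <- G].

Lemma edge_ends_cons x y G : edge_ends ((x, y) :: G) = [:: x, y & edge_ends G].
Proof. by []. Qed.

(** An induced matching in colour [c]. *)
Fixpoint edge_pool (h : position) (c : bool) (G : seq (nat * nat)) : bool :=
  if G is e :: G' then
    [&& coloured_adj h c e.1 e.2, e.1 != e.2,
        separated h [:: e.1; e.2] (edge_ends G') & edge_pool h c G']
  else true.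

Lemma edge_pool_rcons h u v d c G :
  u \notin edge_ends G -> edge_pool h c G -> edge_pool (rcons h ((u, v), d)) c G.
Proof.
elim: G => //= -[x y] G IH; rewrite /edge_ends /= !inE !negb_or -/(edge_ends G).
move=> /and3P[ux uy uG] /and4P[xy -> sep P].
rewrite coloured_adj_mono // IH // separated_rcons ?sep //.
  by rewrite !inE (negbTE ux) (negbTE uy).
by rewrite (negbTE uG) andbF.
Qed.

(** [c] is the majority colour of the initial edges, red or blue; the paths [R] and [B] have colours
    [c] and [~~ c] and may be empty. *)
Definition path_state (h : position) (c : bool) (R B : seq nat)
    (G : seq (nat * nat)) : Prop :=
  [/\ induced_path h c R, induced_path h (~~ c) B, edge_pool h c G,
      separated h R B & separated h R (edge_ends G) && separated h B (edge_ends G)].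

Ltac atom H :=
  by apply: separated_sub H => ?; rewrite ?inE => ->; rewrite ?orbT.

(** Refutes that both ends of a new edge lie in given lists, using the separation facts in the
    context. *)
Ltac away :=
  rewrite ?inE;
  repeat match goal with
  | H : is_true (separated _ [:: ?a] [:: ?b]) |- context [?a == ?b] =>
      rewrite (negbTE (separated_neq H))
  | H : is_true (separated _ [:: ?a] [:: ?b]) |- context [?b == ?a] =>
      rewrite [b == a]eq_sym (negbTE (separated_neq H))
  | H : is_true (separated _ [:: ?a] ?T) |- context [?a \in ?T] =>
      rewrite (negbTE (separated_notin H))
  | H : is_true (~~ ?b) |- context [?b] => rewrite (negbTE H)
  | H : is_true (?a != ?b) |- context [?b == ?a] =>
      rewrite [b == a]eq_sym (negbTE H)
  end; rewrite ?andbF.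

(* An edge that does not join the two lists leaves them separated. *)
Ltac frame :=
  repeat (rewrite separated_rcons; [| by away | by away]);
  try assumption; try (rewrite separatedC; assumption).

Ltac split_separated :=
  repeat match goal with
  | |- is_true (separated _ (_ :: ?T) _) =>
      lazymatch T with nil => fail | _ => rewrite separated_cons; apply/andP; split end
  | |- is_true (separated _ _ (_ :: ?T)) =>
      lazymatch T with nil => fail | _ => rewrite separated_consr; apply/andP; split end
  end; frame.

Ltac split_and :=
  repeat match goal with |- is_true (_ && _) => apply/andP; split end.

(** The weights balance the two exchanges: three vertices for [R] against two of [B] gain [12 - 10],
    and two for [B] against two of [R] gain [10 - 8]. A plain extension gains 4 or 5. *)
Lemma path_round h c r (R : seq nat) b (B : seq nat) x y x' y' G :
  path_state h c (r :: R) (b :: B) [:: (x, y), (x', y') & G] ->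
  forces 3 (fun h' => exists (R' B' : seq nat) G',
    [/\ path_state h' c R' B' G', size G <= size G' &
        4 * (size R).+1 + 5 * (size B).+1 + 2 <= 4 * size R' + 5 * size B']) h.
Proof.
move=> [Rp Bp /= /and4P[xy x_y s1 /and4P[x'y' x'_y' s2 Gp]] sRB /andP[sR sB]].
move: s1 sR sB; rewrite /edge_ends /= -/(edge_ends G) => s1 sR sB.
set E := edge_ends G in s1 s2 sR sB.
(* When [r] passes to the other path, its successor in [R] must go as well, being adjacent to [r];
   [R2] is what remains. [B2] plays the same role for [b]. *)
have [R2 [R2R R2p sR2 szR2]] : exists R2 : seq nat, [/\ {subset R2 <= R},
    induced_path h c R2, separated h [:: r] R2 & size R <= (size R2).+1].
  exists (behead R); split; first exact: mem_behead.
  - by case/and3P: Rp => _ _ /induced_path_behead.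
  - exact: induced_path_head_separated Rp.
  - by rewrite size_behead leqSpred.
have [B2 [B2B B2p sB2 szB2]] : exists B2 : seq nat, [/\ {subset B2 <= B},
    induced_path h (~~ c) B2, separated h [:: b] B2 & size B <= (size B2).+1].
  exists (behead B); split; first exact: mem_behead.
  - by case/and3P: Bp => _ _ /induced_path_behead.
  - exact: induced_path_head_separated Bp.
  - by rewrite size_behead leqSpred.
have rR : r \notin R by case/and3P: Rp.
have bB : b \notin B by case/and3P: Bp.
have rx : separated h [:: r] [:: x] by atom sR.
have ry : separated h [:: r] [:: y] by atom sR.
have rx' : separated h [:: r] [:: x'] by atom sR.
have ry' : separated h [:: r] [:: y'] by atom sR.
have rE : separated h [:: r] E by atom sR.
have rb : separated h [:: r] [:: b] by atom sRB.
have rB : separated h [:: r] B by atom sRB.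
have bx : separated h [:: b] [:: x] by atom sB.
have bx' : separated h [:: b] [:: x'] by atom sB.
have by_' : separated h [:: b] [:: y'] by atom sB.
have bE : separated h [:: b] E by atom sB.
have bR : separated h [:: b] R by rewrite separatedC; atom sRB.
have xx' : separated h [:: x] [:: x'] by atom s1.
have xy'' : separated h [:: x] [:: y'] by atom s1.
have xE : separated h [:: x] E by atom s1.
have x'E : separated h [:: x'] E by atom s2.
have y'E : separated h [:: y'] E by atom s2.
have xR : separated h [:: x] R by rewrite separatedC; atom sR.
have xB : separated h [:: x] B by rewrite separatedC; atom sB.
have x'R : separated h [:: x'] R by rewrite separatedC; atom sR.
have x'B : separated h [:: x'] B by rewrite separatedC; atom sB.
have y'R : separated h [:: y'] R by rewrite separatedC; atom sR.
have y'B : separated h [:: y'] B by rewrite separatedC; atom sB.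
have RB : separated h R B by atom sRB.
have RE : separated h R E by atom sR.
have BE : separated h B E by atom sB.
apply: (@forces_move _ _ _ r x);
  [by move: rx; rewrite separated_seq1 => /andP[] .. |].
move=> c1; set h1 := rcons _ _.
have [c1E|c1E] := eqVneq c1 c.
  apply: forces_done; exists (x :: r :: R), (b :: B), ((x', y') :: G).
  split; [|by []|by clear; move=> /=; lia].
  rewrite /h1 c1E; split; rewrite ?edge_ends_cons -?/E.
  - rewrite [induced_path _ _ _]/= -/(induced_path _ c (r :: R)).
    rewrite [coloured_adj _ _ x r]coloured_adjC coloured_adj_new.
    rewrite induced_path_rcons ?Rp ?andbT; last by away.
    by apply/andP; split; [away | frame].
  - by rewrite induced_path_rcons ?Bp //; away.
  - apply: edge_pool_rcons; first by rewrite edge_ends_cons -/E; away.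
    by rewrite /= x'y' x'_y' s2.
  - by split_separated.
  - by apply/andP; split; split_separated.
(* From here on [r], [x] is a path in the colour of [B], ready to be appended at [b]. *)
have {}c1E : c1 = ~~ c by case: (c1) (c) c1E => [] [].
rewrite {}c1E in h1 *.
have Gp1 : edge_pool h1 c G by apply: edge_pool_rcons => //; away.
have Rp1 : induced_path h1 c (r :: R) by rewrite induced_path_rcons ?Rp //; away.
have Bp1 : induced_path h1 (~~ c) (b :: B) by rewrite induced_path_rcons ?Bp //; away.
have bx'1 : separated h1 [:: b] [:: x'] by rewrite /h1; frame.
apply: (@forces_move _ _ _ b x');
  [by move: bx'1; rewrite separated_seq1 => /andP[] .. |].
move=> c2; set h2 := rcons _ _.
have Gp2 : edge_pool h2 c G by apply: edge_pool_rcons => //; away.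
have Rp2 : induced_path h2 c (r :: R) by rewrite induced_path_rcons ?Rp1 //; away.
have Bp2 : induced_path h2 (~~ c) (b :: B) by rewrite induced_path_rcons ?Bp1 //; away.
have [c2E|c2E] := eqVneq c2 (~~ c).
  apply: forces_done; exists (r :: R), (x' :: b :: B), G.
  split; [|by []|by clear; move=> /=; lia].
  split=> //; rewrite -?/E.
  - rewrite [induced_path _ _ _]/= -/(induced_path _ (~~ c) (b :: B)) Bp2 andbT.
    rewrite [coloured_adj _ _ x' b]coloured_adjC {1}/h2 c2E coloured_adj_new.
    by apply/andP; split; [away | rewrite /h2 /h1; frame].
  - by rewrite /h2 /h1; split_separated.
  - by rewrite /h2 /h1; apply/andP; split; split_separated.
(* Likewise [b], [x'], [y'] is now a path in the colour of [R]. The colour of [rb] decides which of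
   the two exchanges takes place. *)
have {}c2E : c2 = c by case: (c2) (c) c2E => [] [].
rewrite {}c2E in h2 Gp2 Rp2 Bp2 *.
have rb2 : separated h2 [:: r] [:: b] by rewrite /h2 /h1; frame.
apply: (@forces_move _ _ _ r b);
  [by move: rb2; rewrite separated_seq1 => /andP[] .. |].
move=> c3; set h3 := rcons _ _; apply: forces_done.
have Gp3 : edge_pool h3 c G by apply: edge_pool_rcons => //; away.
have r_B : separated h [:: r] B2 by apply: separated_sub rB.
have x_B : separated h [:: x'] B2 by apply: separated_sub x'B.
have z_B : separated h [:: x] B2 by apply: separated_sub xB.
have z_R : separated h [:: x'] R2 by apply: separated_sub x'R.
have y_B : separated h [:: y'] B2 by apply: separated_sub y'B.
have R_B : separated h R B2 by apply: separated_sub RB.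
have B_E : separated h B2 E by apply: separated_sub BE.
have b_R : separated h [:: b] R2 by apply: separated_sub bR.
have x_R : separated h [:: x] R2 by apply: separated_sub xR.
have B_R : separated h B R2 by rewrite separatedC; apply: separated_sub RB.
have R_E : separated h R2 E by apply: separated_sub RE.
have [c3E|c3E] := eqVneq c3 c.
  exists (y' :: x' :: b :: r :: R), B2, G; split=> //; last first.
    by clear -szB2; move=> /=; lia.
  split=> //.
  - have Rp3 : induced_path h3 c (r :: R) by rewrite induced_path_rcons ?Rp2 //; away.
    rewrite [induced_path _ _ _]/= -/(induced_path _ c (r :: R)) Rp3 andbT.
    have -> : coloured_adj h3 c y' x'.
      by rewrite coloured_adjC; do 3 apply: coloured_adj_mono.
    have -> : coloured_adj h3 c x' b.
      by rewrite coloured_adjC; apply/coloured_adj_mono/coloured_adj_new.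
    have -> : coloured_adj h3 c b r.
      by rewrite coloured_adjC /h3 c3E; apply: coloured_adj_new.
    rewrite /= /h3 /h2 /h1.
    by split_and; solve [by away | by split_separated].
  - by rewrite /h3 /h2 /h1; do 3 (rewrite induced_path_rcons; last by away).
  - by rewrite /h3 /h2 /h1; split_separated.
  - by rewrite /h3 /h2 /h1 -/E; apply/andP; split; split_separated.
have {}c3E : c3 = ~~ c by case: (c3) (c) c3E => [] [].
exists R2, (x :: r :: b :: B), G; split=> //; last first.
  by clear -szR2; move=> /=; lia.
split=> //.
- by rewrite /h3 /h2 /h1; do 3 (rewrite induced_path_rcons; last by away).
- have Bp3 : induced_path h3 (~~ c) (b :: B) by rewrite induced_path_rcons ?Bp2 //; away.
  rewrite [induced_path _ _ _]/= -/(induced_path _ (~~ c) (b :: B)) Bp3 andbT.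
  have -> : coloured_adj h3 (~~ c) x r.
    by rewrite coloured_adjC; do 2 apply: coloured_adj_mono; apply: coloured_adj_new.
  have -> : coloured_adj h3 (~~ c) r b by rewrite /h3 c3E; apply: coloured_adj_new.
  rewrite /= /h3 /h2 /h1.
  by split_and; solve [by away | by split_separated].
- by rewrite /h3 /h2 /h1; split_separated.
- by rewrite /h3 /h2 /h1 -/E; apply/andP; split; split_separated.
Qed.

(** Each of the [T] rounds takes at most three moves and two pool edges, and raises the potential by
    at least 2. Once it reaches [9 * n], one of the paths has [n] vertices. *)
Lemma path_rounds n T h c (R B : seq nat) (G : seq (nat * nat)) :
  path_state h c R B G -> 2 * T <= size G ->
  9 * n <= 4 * size R + 5 * size B + 2 * T ->
  forces (3 * T) (fun h' => exists d (s : seq nat),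
    induced_path h' d s /\ n <= size s) h.
Proof.
elim: T h R B G => [|T IH] h R B G st.
  move=> _ le_n; apply: forces_done; have [Rp Bp _ _ _] := st.
  have [le_nR|lt_Rn] := leqP n (size R); first by exists c, R.
  by exists (~~ c), B; split=> //; clear -le_n lt_Rn; lia.
case: G st => [|[x y] [|[x' y'] G]] st; [by rewrite mulnS | by rewrite mulnS|].
rewrite mulnS /= => le_G le_n.
have {}le_G : 2 * T <= size G by clear -le_G; lia.
(* An empty path is restarted at an end of a pool edge; this gains at least 4 without any move. *)
case: R B st le_n => [|r R] B st le_n.
  have [_ Bp /and4P[_ _ s1 P] _ /andP[_ sB]] := st.
  apply: (@forces_leq (3 * T)); first by rewrite mulnS leq_addl.
  apply: (IH _ [:: x] B ((x', y') :: G));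
    [|by apply: leqW|by clear -le_n; move: le_n => /=; lia].
  split=> //.
  - by rewrite separatedC; apply: separated_sub sB => // z; rewrite !inE => ->.
  - apply/andP; split; [apply: separated_sub s1|apply: separated_sub sB] => // z;
      by rewrite ?edge_ends_cons ?inE => ->; rewrite ?orbT.
case: B st le_n => [|b B] st le_n.
  have [Rp _ /and4P[_ _ s1 P] _ /andP[sR _]] := st.
  apply: (@forces_leq (3 * T)); first by rewrite mulnS leq_addl.
  apply: (IH _ (r :: R) [:: x] ((x', y') :: G));
    [|by apply: leqW|by clear -le_n; move: le_n => /=; lia].
  split=> //.
  - by apply: separated_sub sR => // z; rewrite !inE => ->.
  - apply/andP; split; [apply: separated_sub sR|apply: separated_sub s1] => // z;
      by rewrite ?edge_ends_cons ?inE => ->; rewrite ?orbT.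
rewrite mulnS; apply: forces_bind (path_round st) _ => h' [R' [B' [G' [st' le_G' le']]]].
apply: IH st' _ _; first exact: leq_trans le_G le_G'.
by clear -le_n le'; move: le_n le' => /=; lia.
Qed.

(** The edges drawn are [{2i, 2i + 1}] for [i < M], sorted by colour. The bounds by [2 * M] carry
    the freshness of the next edge through the induction. *)
Lemma forces_edge_pools M :
  forces M (fun h => exists G1 G2,
    [/\ edge_pool h true G1, edge_pool h false G2, size G1 + size G2 = M,
        forall x, x \in edge_ends G1 ++ edge_ends G2 -> x < 2 * M &
        forall x y, adj h x y -> x < 2 * M]) [::].
Proof.
elim: M => [|M IH]; first by apply: forces_done; exists [::], [::].
rewrite -addn1; apply: forces_bind IH _ => h [G1 [G2 [P1 P2 szG ltG lth]]].
have nadj x y : 2 * M <= x -> adj h x y = false.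
  by move=> le_x; apply/negP => /lth; rewrite ltnNge le_x.
have nG x : 2 * M <= x -> x \notin edge_ends G1 ++ edge_ends G2.
  by move=> le_x; apply/negP => /ltG; rewrite ltnNge le_x.
have nG1 x : 2 * M <= x -> x \notin edge_ends G1.
  by move/nG; rewrite mem_cat negb_or => /andP[].
have nG2 x : 2 * M <= x -> x \notin edge_ends G2.
  by move/nG; rewrite mem_cat negb_or => /andP[].
set u := 2 * M; set v := (2 * M).+1.
have uv : u != v by rewrite /u /v; clear; lia.
have newP (G : seq (nat * nat)) d : (forall x, 2 * M <= x -> x \notin edge_ends G) ->
    edge_pool h d G -> edge_pool (rcons h ((u, v), d)) d ((u, v) :: G).
  move=> nGG P; rewrite /= coloured_adj_new uv edge_pool_rcons ?nGG // andbT /=.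
  rewrite separated_rcons ?(negbTE (nGG u _)) ?(negbTE (nGG v _)) ?andbF //.
  apply/separatedP => x y xuv yG.
  have le_x : 2 * M <= x by move: xuv; rewrite !inE => /orP[] /eqP->.
  rewrite nadj // andbT; apply: contraTneq yG => <-; exact: nGG.
have lt_new d x y : adj (rcons h ((u, v), d)) x y -> x < 2 * (M + 1).
  rewrite adj_rcons => /orP[/lth|]; first by clear; lia.
  by case/orP=> /andP[/eqP e1 /eqP e2]; rewrite ?e1 ?e2 /u /v; clear; lia.
apply: (@forces_move _ _ _ u v) => //; first by rewrite nadj.
case; apply: forces_done.
  exists ((u, v) :: G1), G2; split=> //;
    [exact: newP | by apply: edge_pool_rcons; first exact: nG2
    | by rewrite -szG /=; clear; lia | | exact: lt_new].
  move=> x; rewrite edge_ends_cons !inE => /or3P[/eqP->|/eqP->|/ltG];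
    by rewrite /u /v; clear; lia.
exists G1, ((u, v) :: G2); split=> //;
  [by apply: edge_pool_rcons; first exact: nG1 | exact: newP
  | by rewrite -szG /=; clear; lia | | exact: lt_new].
move=> x; rewrite edge_ends_cons mem_cat !inE => /or4P[xG|/eqP->|/eqP->|xG];
  rewrite /u /v; try (clear; lia).
- by have := ltG x; rewrite mem_cat xG => /(_ isT); clear; lia.
- by have := ltG x; rewrite mem_cat xG orbT => /(_ isT); clear; lia.
Qed.

Lemma forces_induced_path n :
  forces (35 * n) (fun h => exists c (s : seq nat),
    induced_path h c s /\ n <= size s) [::].
Proof.
(* The potential must reach [9 * n] in steps of 2, so [5 * n] rounds suffice. They use [10 * n] pool
   edges, which the majority colour among [20 * n] edges supplies. *)
have -> : 35 * n = 20 * n + 3 * (5 * n) by lia.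
apply: forces_bind (forces_edge_pools _) _ => h [G1 [G2 [P1 P2 szG _ _]]].
have st c G : edge_pool h c G -> path_state h c [::] [::] G by [].
have [le_n|lt_n] := leqP (2 * (5 * n)) (size G1).
  by apply: (path_rounds (st true G1 P1)) => //=; clear; lia.
apply: (path_rounds (st false G2 P2)) => /=; last by clear; lia.
by clear -lt_n szG; lia.
Qed.

(** * Growing a spider from an induced path *)

Definition loopless (h : position) : Prop := forall x, ~~ adj h x x.

(** An arbitrary [position] may list loops, but legal moves never create one; the target may thus
    assume their absence, as an induced copy requires. *)
Lemma forces_loopless m (Q : position -> Prop) h :
  loopless h -> forces m (fun h' => loopless h' -> Q h') h -> forces m Q h.
Proof.
elim: m h => [|m IH] h lh [Qh|] //; try by apply: forces_done; apply: Qh.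
move=> [[u v] [le F]]; right; exists (u, v); split=> // c; apply: IH (F c).
move=> x; rewrite adj_rcons negb_or lh andbC /=; move: le => /andP[/= uv _].
by case: eqP => [->|]; case: eqP => [e|] //=; case/eqP: uv.
Qed.

Lemma separated_same h h' s t :
  {in s & t, forall x y, adj h' x y = adj h x y} ->
  separated h s t -> separated h' s t.
Proof. by move=> H /separatedP S; apply/separatedP => x y xs yt; rewrite H ?S. Qed.

Lemma induced_path_same h h' c s :
  {in s &, forall x y d, coloured_adj h' d x y = coloured_adj h d x y} ->
  induced_path h c s -> induced_path h' c s.
Proof.
elim: s => //= x s IH H /and3P[-> xy P].
rewrite IH ?andbT //=; last by move=> y z ys zs d; apply: H; rewrite inE ?ys ?zs orbT.
case: s xy H {IH P} => //= y s /andP[xy xs] H; rewrite H ?inE ?eqxx ?orbT ?xy //=.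
apply: separated_same xs => u z /[1!inE] /eqP-> zs.
by rewrite /adj !H ?inE ?eqxx ?zs ?orbT.
Qed.

Lemma induced_path_cons h c x s :
  s != [::] -> x \notin s -> coloured_adj h c x (head 0 s) ->
  separated h [:: x] (behead s) -> induced_path h c s -> induced_path h c (x :: s).
Proof. by case: s => //= y s _ -> -> -> ->. Qed.

Lemma spider_copy h c k l v (leg : 'I_k -> seq nat) :
  loopless h -> (forall i, induced_path h c (v :: leg i)) ->
  (forall i, l <= size (leg i)) ->
  (forall i j, i != j -> separated h (leg i) (leg j)) ->
  mono_induced_copy (spider k l) h.
Proof.
move=> lh P sz sep.
pose f (x : spider k l) := if x is Some (i, j) then nth 0 (leg i) (nat_of_ord j) else v.
have szj i (j : 'I_l) : j < size (leg i) by apply: leq_trans (ltn_ord j) (sz i).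
have mem i (j : 'I_l) : nth 0 (leg i) j \in leg i by rewrite mem_nth.
have same i (j j' : 'I_l) : adj h (nth 0 (leg i) j) (nth 0 (leg i) j') =
    (j' == j.+1 :> nat) || (j == j'.+1 :> nat).
  have [lt_j|lt_j|<-] := ltngtP j j'.
  - have [|/= -> _] := @induced_path_nth h c _ j.+1 j'.+1 (P i).
      by rewrite /= !ltnS lt_j szj.
    by rewrite eqSS [X in _ || X]ltn_eqF ?orbF // ltnS ltnW.
  - have [|/= E _] := @induced_path_nth h c _ j'.+1 j.+1 (P i).
      by rewrite /= !ltnS lt_j szj.
    by rewrite adjC E eqSS [X in X || _]ltn_eqF // ltnS ltnW.
  - by rewrite (negbTE (lh _)) ltn_eqF.
have root i (j : 'I_l) : adj h v (nth 0 (leg i) j) = (j == 0 :> nat).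
  have [|/= -> _] := @induced_path_nth h c _ 0 j.+1 (P i); last by [].
  by rewrite /= ltnS szj.
have vnot i (j : 'I_l) : (nth 0 (leg i) j == v) = false.
  by apply: contraTF (P i) => /eqP E; rewrite /= -{1}E mem.
exists f, c; split.
- move=> [[i j]|] [[i' j']|] //=.
  + have [<-|ii'] := eqVneq i i'.
      have /induced_path_uniq /= /andP[_ uniq_i] := P i.
      by move/eqP; rewrite nth_uniq ?szj // => /eqP/ord_inj->.
    have /separatedP/(_ _ _ (mem i j) (mem i' j')) := sep _ _ ii'.
    by case/andP=> /eqP nE _ /nE.
  + by move/eqP; rewrite vnot.
  + by move/esym/eqP; rewrite vnot.
- move=> [[i j]|] [[i' j']|] /=; last by apply: negbTE.
  + have [<-|ii'] /= := eqVneq i i'; first by rewrite same.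
    by have /separatedP/(_ _ _ (mem i j) (mem i' j'))/andP[_ /negbTE] := sep _ _ ii'.
  + by rewrite adjC root.
  + by rewrite root.
- have col i (j j' : 'I_l) : j' = j.+1 :> nat ->
      coloured_adj h c (nth 0 (leg i) j) (nth 0 (leg i) j').
    move=> jj'; have [|/= _ H] := @induced_path_nth h c _ j.+1 j'.+1 (P i).
      by rewrite /= !ltnS jj' leqnn -jj' szj.
    by apply: H; rewrite jj'.
  have rootc i (j : 'I_l) : j = 0 :> nat -> coloured_adj h c v (nth 0 (leg i) j).
    move=> j0; have [|/= _ H] := @induced_path_nth h c _ 0 j.+1 (P i).
      by rewrite /= ltnS szj.
    by apply: H; rewrite j0.
  move=> [[i j]|] [[i' j']|] //=.
  + by case/andP=> /eqP<- /orP[] /eqP E; [|rewrite coloured_adjC]; apply: col.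
  + by move/eqP; rewrite coloured_adjC; apply: rootc.
  + by move/eqP; apply: rootc.
Qed.

(** An equality rather than an implication, so that pairs outside the star provably keep their
    status. *)
Definition star_extension (h h' : position) (v : nat) (A : seq nat)
    (col : nat -> bool) : Prop :=
  forall c x y, coloured_adj h' c x y =
    [|| coloured_adj h c x y, [&& x == v, y \in A & col y == c]
      | [&& y == v, x \in A & col x == c]].

Lemma forces_star h v (A : seq nat) :
  uniq A -> separated h [:: v] A ->
  forces (size A) (fun h' => exists col, star_extension h h' v A col) h.
Proof.
elim: A h => [|a A IH] h /=.
  move=> _ _; apply: forces_done; exists xpredT => c x y.
  by rewrite !in_nil !andbF !orbF.
move=> /andP[aA uA]; rewrite separated_consr => /andP[va vA].
move: (va); rewrite separated_seq1 => /andP[va1 va2].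
apply: (forces_move va1 va2) => d.
have {}vA : separated (rcons h ((v, a), d)) [:: v] A.
  rewrite separated_rcons // !inE ?eqxx /= ?(negbTE aA) //.
  by rewrite eq_sym (negbTE va1).
rewrite -[size A]addn0; apply: forces_bind (IH _ uA vA) _ => h' [col H].
apply: forces_done; exists (fun z => if z == a then d else col z) => c x y.
rewrite H coloured_adj_rcons !inE eq_sym.
have [->|xa] := eqVneq x a; have [->|ya] := eqVneq y a;
  rewrite ?(negbTE aA) ?[a == v]eq_sym ?(negbTE va1) /= ?andbF ?orbF ?andbT //=.
- by rewrite andbC.
- by rewrite andbC.
Qed.

Definition heads n (seg : 'I_n -> seq nat) : seq nat :=
  [seq head 0 (seg j) | j <- enum 'I_n].

Lemma mem_heads n (seg : 'I_n -> seq nat) j : head 0 (seg j) \in heads seg.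
Proof. by apply: map_f; rewrite mem_enum. Qed.

Definition path_family (h : position) (d : bool) (e n : nat)
    (seg : 'I_n -> seq nat) : Prop :=
  [/\ forall j, induced_path h d (seg j), forall j, 0 < size (seg j),
      forall i j, i != j -> separated h (seg i) (seg j) &
      forall j, separated h [:: e] (seg j)].

Lemma head_mem (s : seq nat) : 0 < size s -> head 0 s \in s.
Proof. by case: s => //= x s _; rewrite mem_head. Qed.

Lemma mem_drop2 (s : seq nat) x : x \in drop 2 s -> x \in behead s.
Proof. by case: s => [|y [|z s]] //=; rewrite drop0 inE => ->; rewrite orbT. Qed.

Lemma behead_notin_heads h d e n (seg : 'I_n -> seq nat) j x :
  path_family h d e seg -> x \in behead (seg j) -> x \notin heads seg.
Proof.
move=> [P sz sep _] xj; apply/mapP => -[i _ E].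
have [ij|ij] := eqVneq i j.
  have := induced_path_uniq (P j); rewrite ij in E; rewrite {}E in xj.
  by case: (seg j) xj => //= y s -> .
have xi : x \in seg i by rewrite E head_mem.
have /separatedP/(_ x x xi (mem_behead xj)) := sep _ _ ij.
by rewrite eqxx.
Qed.

(** Only pairs formed by [e] and a head change. A segment whose head is joined to [e] in its own
    colour [d] is therefore prolonged by [e], its other vertices staying separated from [e]. *)
Lemma forces_heads h d e n (seg : 'I_n -> seq nat) :
  path_family h d e seg ->
  forces n (fun h' => exists col : 'I_n -> bool,
    [/\ forall j, coloured_adj h' (col j) e (head 0 (seg j)),
        forall (x y : nat) c, (x != e) || (y \notin heads seg) ->
          (y != e) || (x \notin heads seg) ->
          coloured_adj h' c x y = coloured_adj h c x y &
        forall j, col j = d -> induced_path h' d (e :: seg j)]) h.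
Proof.
move=> F; have [P sz sep esep] := F.
have uA : uniq (heads seg).
  rewrite map_inj_in_uniq ?enum_uniq // => i j _ _ E; apply/eqP; apply/negP => /negP ij.
  have /separatedP/(_ (head 0 (seg i)) (head 0 (seg j))) := sep _ _ ij.
  by rewrite !head_mem // E eqxx => /(_ isT isT).
have eA : separated h [:: e] (heads seg).
  apply/separatedP => x y xe /mapP[j _ ->].
  by have /separatedP := esep j; apply=> //; apply: head_mem.
have eN : e \notin heads seg by apply: separated_notin eA.
have szA : size (heads seg) = n by rewrite size_map size_enum_ord.
apply: (@forces_leq (size (heads seg) + 0)); first by rewrite addn0 szA.
apply: forces_bind (forces_star uA eA) _ => h' [col H].
have same x y c : (x != e) || (y \notin heads seg) -> (y != e) || (x \notin heads seg) ->
    coloured_adj h' c x y = coloured_adj h c x y.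
  rewrite H; case: (x == e); case: (y == e); case: (x \in _); case: (y \in _) => //=;
    by rewrite ?orbF.
apply: forces_done; exists (fun j => col (head 0 (seg j))).
have new j : coloured_adj h' (col (head 0 (seg j))) e (head 0 (seg j)).
  by rewrite H !eqxx mem_heads orbT.
split=> // j colj; apply: induced_path_cons.
- by rewrite -size_eq0 -lt0n.
- exact: separated_notin (esep j).
- by rewrite -colj; apply: new.
- apply: separated_same (_ : separated h _ _).
    move=> x y /[1!inE] /eqP-> yj.
    by rewrite /adj !same ?(behead_notin_heads F yj) ?orbT ?eN ?orbT.
  by apply: separated_sub (esep j) => // z; apply: mem_behead.
- apply: induced_path_same (P j) => x y xj yj c.
  have nee z : z \in seg j -> z != e.
    by move=> zj; apply: contraNneq (separated_notin (esep j)) => <-.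
  by rewrite same ?nee.
Qed.

(* Legs are listed from their far end towards the root [v], so they grow at the
   head of the list. *)
Definition spider_state (h : position) (c : bool) (k v : nat)
    (leg seg : 'I_k -> seq nat) : Prop :=
  [/\ forall i, induced_path h c (rcons (leg i) v), forall i, 0 < size (leg i),
      forall i j, i != j -> separated h (leg i) (leg j),
      forall j, induced_path h (~~ c) (seg j) &
      (forall i j, i != j -> separated h (seg i) (seg j)) /\
      (forall i j, separated h (rcons (leg i) v) (seg j))].

(** [T] counts the vertices still missing from the legs. Each costs [k] edges and two vertices of
    every segment; the [l] vertices kept in reserve let the segments serve as legs at any stage. *)
Lemma spider_grow k l T h c v (leg seg : 'I_k -> seq nat) :
  spider_state h c v leg seg ->
  (forall i, size (leg i) <= l) -> \sum_i (l - size (leg i)) = T ->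
  (forall j, l + 2 * T <= size (seg j)) ->
  forces (T * k)
    (fun h' => loopless h' -> mono_induced_copy (spider k l) h') h.
Proof.
elim: T h leg seg => [|T IH] h leg seg st le_l sumT szs.
  apply: forces_done => lh; have [P _ lsep _ _] := st.
  apply: (@spider_copy h c k l v (fun i => rev (leg i))) => // [i|i|i j ij].
  - by rewrite -rev_rcons; apply: induced_path_rev.
  - rewrite size_rev; move/eqP: sumT; rewrite sum_nat_eq0 => /forallP/(_ i).
    by rewrite subn_eq0.
  - by apply: separated_sub (lsep _ _ ij) => x; rewrite mem_rev.
have [i lt_i] : exists i, size (leg i) < l.
  apply/existsP; apply: contraPT sumT; rewrite negb_exists => /forallP H.
  rewrite big1 // => i _; have := H i; rewrite -leqNgt => le_i.
  by apply/eqP; rewrite subn_eq0.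
have [P lpos lsep S [ssep lssep]] := st.
have [e [L legE]] : exists e L, leg i = e :: L.
  by case: (leg i) (lpos i) => // e L _; exists e, L.
have ei : e \in leg i by rewrite legE mem_head.
have eiv : e \in rcons (leg i) v by rewrite mem_rcons inE ei orbT.
have spos j : 0 < size (seg j) by apply: leq_trans (szs j); rewrite mulnS addnA addn2.
have F : path_family h (~~ c) e seg.
  split=> // j; apply: separated_sub (lssep i j) => // x; by rewrite inE => /eqP->.
rewrite mulSn; apply: forces_bind (forces_heads F) _ => h' [col [new same blue]].
(* If no new edge has colour [c], then [e] is the centre of a spider of colour [~~ c] with the
   segments as legs. *)
have [/existsP[j /eqP colj]|] := boolP [exists j, col j == c]; last first.
  rewrite negb_exists => /forallP allblue; apply: forces_done => lh.
  apply: (@spider_copy h' (~~ c) k l e seg) => // [j|j|j1 j2 j12].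
  - by apply: blue; have := allblue j; case: (col j) (c) => [] [].
  - by apply: leq_trans (szs j); rewrite leq_addr.
  - have nee z j' : z \in seg j' -> z != e.
      move=> zj; have /separatedP/(_ e z eiv zj) := lssep i j'.
      by rewrite eq_sym => /andP[].
    apply: separated_same (ssep _ _ j12) => x y xj yj.
    by rewrite /adj !same // ?(nee _ _ xj) ?(nee _ _ yj).
set a := head 0 (seg j).
have aj : a \in seg j by apply: head_mem.
have legN i' x : x \in rcons (leg i') v -> x \notin heads seg.
  move=> xi; apply/mapP => -[j' _ E].
  have /separatedP/(_ x x xi) := lssep i' j'.
  by rewrite {1}E head_mem // eqxx => /(_ isT).
have legN' i' x : x \in leg i' -> x \notin heads seg.
  by move=> xi; apply: (@legN i'); rewrite mem_rcons inE xi orbT.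
have dropN j' x : x \in drop 2 (seg j') -> x \notin heads seg.
  by move/mem_drop2; apply: behead_notin_heads F.
have dropS j' x : x \in drop 2 (seg j') -> x \in seg j' by move/mem_drop.
have same2 x y d : x \notin heads seg -> y \notin heads seg ->
    coloured_adj h' d x y = coloured_adj h d x y.
  by move=> nx ny; rewrite same ?nx ?ny ?orbT.
have same_a y : y != e -> adj h' a y = adj h a y.
  move=> ye; have ae : a != e by apply: contraNneq (legN i e eiv) => <-; apply: mem_heads.
  by rewrite /adj !same ?ye ?ae.
pose leg' i' := if i' == i then a :: leg i else leg i'.
have sum' : \sum_i' (l - size (leg' i')) = T.
  rewrite (bigD1 i) //= {1}/leg' eqxx.
  rewrite (eq_bigr (fun i' => l - size (leg i'))); last first.
    by move=> i' /negbTE ii'; rewrite /leg' ii'.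
  move: sumT; rewrite (bigD1 i) //=; clear -lt_i; lia.
(* First vertices are dropped because [e] is now adjacent to them, second ones because that of
   segment [j] is adjacent to [a]. *)
apply: (IH h' leg' (fun j' => drop 2 (seg j'))) => //; last first.
- by move=> j'; rewrite size_drop; have := szs j'; clear; lia.
- by move=> i'; rewrite /leg'; case: ifP.
split.
- move=> i'; rewrite /leg'; case: eqP => [_|_]; last first.
    by apply: induced_path_same (P i') => x y xi yi d; rewrite same2 ?(legN i').
  rewrite rcons_cons; apply: induced_path_cons.
  + by case: (leg i).
  + by apply/negP => /legN; rewrite mem_heads.
  + by rewrite legE /= coloured_adjC -colj; apply: new.
  + rewrite legE /=; apply: separated_same (_ : separated h _ _).
      move=> x y /[1!inE] /eqP-> yL; apply: same_a.
      apply: contraTneq yL => ->.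
      by have := induced_path_uniq (P i); rewrite legE /= => /andP[].
    rewrite separatedC; apply: separated_sub (lssep i j) => x.
      by rewrite legE /= inE => ->; rewrite orbT.
    by rewrite inE => /eqP->.
  + by apply: induced_path_same (P i) => x y xi yi d; rewrite same2 ?(legN i).
- by move=> i'; rewrite /leg'; case: ifP.
- have sep_a i2 : i2 != i -> separated h' [:: a] (leg i2).
    move=> ii2; apply: separated_same (_ : separated h _ _).
      move=> x y /[1!inE] /eqP-> yi; apply: same_a.
      have /separatedP/(_ y e yi ei) := lsep _ _ ii2; by case/andP.
    rewrite separatedC; apply: separated_sub (lssep i2 j) => x.
      by rewrite mem_rcons inE => ->; rewrite orbT.
    by rewrite inE => /eqP->.
  have sep' i1 i2 : i1 != i2 -> separated h' (leg i1) (leg i2).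
    move=> i12; apply: separated_same (lsep _ _ i12) => x y xi yi.
    by rewrite /adj !same2 ?(legN' i1 x) ?(legN' i2 y).
  move=> i1 i2 i12; rewrite /leg'.
  case: eqP => [E1|/eqP n1]; case: eqP => [E2|/eqP n2].
  + by rewrite E1 E2 eqxx in i12.
  + by rewrite separated_cons sep_a // sep' // eq_sym.
  + by rewrite separated_consr separatedC sep_a // sep'.
  + exact: sep'.
- move=> j'; apply: induced_path_same (_ : induced_path h _ _);
    last exact: induced_path_drop.
  by move=> x y xj yj d; rewrite same2 ?(dropN j').
split=> [j1 j2 j12|i' j'].
  apply: separated_same (_ : separated h _ _).
    by move=> x y xj yj; rewrite /adj !same2 ?(dropN j1 x) ?(dropN j2 y).
  by apply: separated_sub (ssep _ _ j12) => x /mem_drop.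
have sep' i1 : separated h' (rcons (leg i1) v) (drop 2 (seg j')).
  apply: separated_same (_ : separated h _ _).
    by move=> x y xj yj; rewrite /adj !same2 ?(legN i1 x) ?(dropN j' y).
  by apply: separated_sub (lssep i1 j') => // x /mem_drop.
rewrite /leg'; case: ifP => // _; rewrite rcons_cons separated_cons sep' andbT.
apply: separated_same (_ : separated h _ _).
  move=> x y /[1!inE] /eqP-> yj; apply: same_a.
  have /separatedP/(_ e y eiv (dropS _ _ yj)) := lssep i j'.
  by rewrite eq_sym => /andP[].
have [<-|jj'] := eqVneq j j'; last first.
  apply: separated_sub (ssep _ _ jj') => x; last exact: mem_drop.
  by rewrite inE => /eqP->.
have := S j; rewrite /a; case: (seg j) => [//|z s] /induced_path_head_separated.
by rewrite /= -drop1.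
Qed.

Lemma monochromatic_half k (col : 'I_(k + k) -> bool) :
  exists c (f : 'I_k -> 'I_(k + k)), injective f /\ forall i, col (f i) = c.
Proof.
have main c : k <= #|[pred j | col j == c]| ->
    exists f : 'I_k -> 'I_(k + k), injective f /\ forall i, col (f i) = c.
  move=> le_k; exists (fun i => enum_val (widen_ord le_k i)); split.
    by move=> i j /enum_val_inj /(congr1 val) /= /ord_inj.
  by move=> i; have /eqP := enum_valP (widen_ord le_k i).
have [/main H|] := leqP k #|[pred j | col j == true]|; first by exists true.
have /= := cardC [pred j | col j == true]; rewrite card_ord => card_sum lt_k.
exists false; apply: main.
rewrite (eq_card (B := [predC [pred j | col j == true]])); last first.
  by move=> j; rewrite !inE; case: (col j).
by rewrite -(leq_add2l #|[pred j | col j == true]|) card_sum leq_add2r ltnW.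
Qed.

Lemma spider_from_path k l h d (p : seq nat) :
  0 < k -> 0 < l -> induced_path h d p ->
  2 + (k + k) * (3 * (k * l)).+1 <= size p ->
  forces (k + k + k * l.-1 * k)
    (fun h' => loopless h' -> mono_induced_copy (spider k l) h') h.
Proof.
move=> k_gt0 l_gt0 P szp; set S := 3 * (k * l) in szp.
have leS : l + 2 * (k * l.-1) + 2 <= S.
  rewrite /S; case: l l_gt0 {szp S} => // l _ /=; clear -k_gt0; nia.
(* The root is the first vertex of [p]. One vertex is skipped after it and one after each segment,
   whence the length [2 + (k + k) * S.+1]. *)
pose seg (j : 'I_(k + k)) := take S (drop (2 + j * S.+1) p).
have szs j : size (seg j) = S.
  rewrite size_take_min size_drop; apply/minn_idPl.
  have := leq_mul (ltn_ord j) (leqnn S.+1); rewrite mulSn => le_j.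
  by move: szp le_j; set a := _ * S.+1; set b := _ * S.+1; clear; lia.
set v := head 0 p.
have F : path_family h d v seg.
  split=> [j|j|i j ij|j].
  - exact/induced_path_take/induced_path_drop.
  - by rewrite szs; move: leS; clear -l_gt0; lia.
  - have lt_sep (i1 i2 : 'I_(k + k)) : i1 < i2 -> separated h (seg i1) (seg i2).
      move=> i12; apply: induced_path_separated P _.
      have := leq_mul i12 (leqnn S.+1); rewrite mulSn.
      by set a := _ * S.+1; set b := _ * S.+1; clear; lia.
    by move: ij; rewrite neq_ltn => /orP[/lt_sep|/lt_sep] //; rewrite separatedC.
  - rewrite (_ : [:: v] = take 1 (drop 0 p)).
      by apply: induced_path_separated P _.
    by rewrite /v; case: (p) szp => [|x s] //= _; rewrite take0.
apply: forces_bind (forces_heads F) _ => h' [col [new same blue]].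
have [Q spos sep vsep] := F.
have [c [f [f_inj colf]]] := monochromatic_half col.
have fneq i j : i != j -> f i != f j by rewrite (inj_eq f_inj).
have vN j z : z \in seg j -> z != v.
  by move=> zj; apply: contraNneq (separated_notin (vsep j)) => <-.
have sep' i j : i != j -> separated h' (seg (f i)) (seg (f j)).
  move=> ij; apply: separated_same (sep _ _ (fneq _ _ ij)) => x y xi yj.
  by rewrite /adj !same ?(vN _ x xi) ?(vN _ y yj).
(* If the majority of root edges has the colour of [p], the chosen segments are already the legs.
   Otherwise their heads are legs of length 1, and [k * l.-1] vertices are missing. *)
have [cd|cd] := eqVneq c d.
  apply: forces_done => lh.
  apply: (@spider_copy h' d k l v (fun i => seg (f i))) => // i.
    by apply: blue; rewrite colf.
  by rewrite szs; move: leS; clear; lia.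
have {}cd : d = ~~ c by case: (c) (d) cd => [] [].
have hd j : head 0 (seg j) \in seg j by apply: head_mem.
have dropS j x : x \in drop 2 (seg j) -> x \in seg j by move/mem_drop.
apply: (@spider_grow k l (k * l.-1) h' c v (fun i => [:: head 0 (seg (f i))])
         (fun i => drop 2 (seg (f i)))) => //; last 2 first.
- by rewrite (eq_bigr (fun=> l.-1)) ?sum_nat_const ?card_ord // => i _; rewrite subn1.
- by move=> j; rewrite size_drop szs; move: leS; clear; lia.
split=> //.
- move=> i; apply: induced_path_cons => //.
    by rewrite inE; apply: vN (hd _).
  by rewrite coloured_adjC -(colf i); apply: new.
- by move=> i j ij; apply: separated_sub (sep' _ _ ij) => x; rewrite inE => /eqP->.
- move=> j; apply: induced_path_same (_ : induced_path h _ _).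
    by move=> x y /dropS xj /dropS yj e; rewrite same ?(vN _ x xj) ?(vN _ y yj).
  by rewrite -cd; apply/induced_path_drop/Q.
split=> [i j ij|i j]; first by apply: separated_sub (sep' _ _ ij) => x; apply: dropS.
rewrite /= separated_cons; apply/andP; split.
  have [<-|ij] := eqVneq i j; last first.
    by apply: separated_sub (sep' _ _ ij) => x; [rewrite inE => /eqP-> | apply: dropS].
  apply: separated_same (_ : separated h _ _).
    move=> x y /[1!inE] /eqP-> /dropS yj.
    by rewrite /adj !same ?(vN _ y yj) ?(vN _ _ (hd (f i))).
  have := Q (f i); case: (seg (f i)) => [//|z s] /induced_path_head_separated.
  by rewrite /= -drop1.
apply: separated_same (_ : separated h _ _).
  move=> x y /[1!inE] /eqP-> yj.
  have yN := behead_notin_heads F (mem_drop2 yj).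
  by rewrite /adj !same ?yN ?(vN _ _ (dropS _ _ yj)) ?orbT.
by apply: separated_sub (vsep (f j)) => // x; apply: dropS.
Qed.

(** * The explicit upper bound and the two-sided estimate *)

Lemma builder_wins_upper k l :
  3 <= k -> 2 <= l -> builder_wins_within (spider k l) (320 * (k ^ 2 * l)).
Proof.
move=> k3 l2; apply: forces_builder_wins.
apply: forces_loopless => //.
set n := 2 + (k + k) * (3 * (k * l)).+1.
(* The cost is at most [211 k^2 l + 72 k + 70]; the lower-order terms are absorbed by [6 k <= k^2 l]
   and [k >= 3]. *)
apply: (@forces_leq (35 * n + (k + k + k * l.-1 * k))).
  rewrite /n -!mulnn.
  have -> : (k + k) * (3 * (k * l)).+1 = 6 * (k * k * l) + 2 * k by clear; lia.
  have le1 : k * l.-1 * k <= k * k * l by rewrite mulnAC leq_mul // leq_pred.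
  have le2 : 6 * k <= k * k * l.
    rewrite -mulnA [6 * k]mulnC leq_mul2l; apply/orP; right.
    exact: leq_mul k3 l2.
  move: le1 le2 k3; set a := k * l.-1 * k; set b := k * k * l; clear; lia.
apply: forces_bind (forces_induced_path n) _ => h [c [p [P szp]]].
by apply: spider_from_path P szp; [apply: leq_trans k3 | apply: leq_trans l2].
Qed.

Lemma least_builder_win H m :
  builder_wins_within H m -> exists r, is_induced_online_ramsey H r.
Proof.
move=> win; have ex : exists m, `[< builder_wins_within H m >].
  by exists m; apply/asboolP.
case: (ex_minnP ex) => r /asboolP win_r min_r.
by exists r; split=> // m' /asboolP; apply: min_r.
Qed.

Import Order.TTheory GRing.Theory Num.Theory.
Local Open Scope ring_scope.

Theorem theorem5 (R : realType) :
  exists c C : R, [/\ 0 < c, 0 < C &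
    forall k l : nat, (3 <= k)%N -> (2 <= l)%N ->
      exists r : nat, is_induced_online_ramsey (spider k l) r /\
        c * (k%:R ^+ 2 * l%:R) <= r%:R <= C * (k%:R ^+ 2 * l%:R)].
Proof.
(* With [l <= 3 * l./2] and [2 * k <= 3 * k.-1], the lower bound [k * l./2 * k.-1 <= 2 * r] gives
   [2 k^2 l <= 18 r], hence the constant [1/9]. *)
exists 9%:R^-1, 320%:R; split; rewrite ?invr_gt0 ?ltr0n // => k l k3 l2.
have win := builder_wins_upper k3 l2.
have [r [win_r min_r]] := least_builder_win win.
exists r; split=> //; rewrite -natrX -!natrM ler_nat min_r // andbT.
rewrite mulrC ler_pdivrMr ?ltr0n // -natrM ler_nat.
have := builder_wins_lower (leq_trans (isT : 0 < 3)%N k3) win_r.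
have lel : (l <= 3 * l./2)%N by clear -l2; lia.
have lek : (2 * k <= 3 * k.-1)%N by clear -k3; lia.
have := leq_mul (leq_mul (leqnn k) lel) lek.
rewrite -mulnn.
have -> : (k * l * (2 * k) = 2 * (k * k * l))%N by clear; lia.
have -> : (k * (3 * l./2) * (3 * k.-1) = 9 * (k * l./2 * k.-1))%N by clear; lia.
set a := (k * k * l)%N; set b := (k * l./2 * k.-1)%N.
by clear; lia.
Qed.
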